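(* Let $D$ be a bounded planar region bounded by finitely many analytic Jordan curves, let $z_1,\ldots,z_m\in D$ be distinct points, and let $k$ be a nonnegative integer. Then there is a constant $C$ (depending on $k$) such that for any $a_{j,l}\in\mathbb C$, $1\le j\le m$, $0\le l\le k$, there exists $f\in H^2(D)$ such that $f^{(l)}(z_j)=a_{j,l}$ for all $1\le j\le m$ and $0\le l\le k$, and $$\frac1{2\pi}\int_{\partial D}|f|^2|dz|\le C\sum_{1\le j\le m}\sum_{0\le l\le k}|a_{j,l}|^2.$$
   Context: The region $D$ and the points $z_1,\dots,z_m$ are fixed; $C$ is independent of the values $a_{j,l}$. $H^2(D)$ is the set of holomorphic $f$ on $D$ such that $|f|^2$ has a harmonic majorant on $D$. Each $f\in H^2(D)$ has nontangential boundary values a.e. on $\partial D$, belonging to $L^2(\partial D)$, again denoted by $f$. $|dz|$ is arc length. *)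

(* Defs.v *)
From HB Require Import structures.
From mathcomp Require Import all_boot all_order all_algebra.
From mathcomp Require Import complex.
From mathcomp Require Import all_classical all_reals all_analysis.

Set Implicit Arguments.
Unset Strict Implicit.
Unset Printing Implicit Defensive.

Import Order.TTheory GRing.Theory Num.Theory numFieldNormedType.Exports.

Local Open Scope classical_set_scope.
Local Open Scope ring_scope.
Local Open Scope complex_scope.

(* R[i] as a normed module over itself: its topology is that of the modulus,
   and the derivatives of functions R[i] -> R[i] are complex derivatives. *)
HB.instance Definition _ (R : rcfType) := NormedModule.copy R[i] R[i]^o.

(* The norm `|z| of the library is R[i]-valued; this is the real one. *)
Notation modulus := Normc.normc.

Section Definitions.
Variable R : realType.
Implicit Types (D : set R[i]) (f fb : R[i] -> R[i]) (u v : R[i] -> R).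

Definition holomorphic_on D f := forall z, D z -> derivable f z 1.

Definition partial_x u (z : R[i]) : R :=
  derive1 (fun t : R => u (t +i* complex.Im z)) (complex.Re z).

Definition partial_y u (z : R[i]) : R :=
  derive1 (fun t : R => u (complex.Re z +i* t)) (complex.Im z).

Definition C1_on D u := forall z, D z ->
  [/\ derivable (fun t : R => u (t +i* complex.Im z)) (complex.Re z) 1,
      derivable (fun t : R => u (complex.Re z +i* t)) (complex.Im z) 1,
      {for z, continuous (partial_x u)} &
      {for z, continuous (partial_y u)}].

Definition C2_on D u :=
  [/\ C1_on D u, C1_on D (partial_x u) & C1_on D (partial_y u)].

Definition harmonic_on D u := C2_on D u /\
  forall z, D z -> partial_x (partial_x u) z + partial_y (partial_y u) z = 0.

(* H^2(D); only the restriction of f to D matters. *)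
Definition hardy2 D f := holomorphic_on D f /\
  exists2 u, harmonic_on D u & forall z, D z -> modulus (f z) ^+ 2 <= u z.

Definition frontier D := closure D `\` interior D.

Definition real_analytic_at (g : R -> R) (t : R) :=
  exists (c : R^nat) (r : R), 0 < r /\
    forall h, `|h| < r -> pseries c h @ \oo --> g (t + h).

Definition curve_deriv (gamma : R -> R[i]) (t : R) : R[i] :=
  derive1 (fun s => complex.Re (gamma s)) t
    +i* derive1 (fun s => complex.Im (gamma s)) t.

(* A regular real-analytic parametrization, of period 1, of a Jordan curve. *)
Definition analytic_jordan_curve (gamma : R -> R[i]) :=
  [/\ forall t, real_analytic_at (fun s => complex.Re (gamma s)) t /\
                real_analytic_at (fun s => complex.Im (gamma s)) t,
      forall t, curve_deriv gamma t != 0,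
      forall t, gamma (t + 1) = gamma t &
      set_inj `[0, 1[ gamma].

Section Boundary.
Variables (D : set R[i]) (n : nat) (gamma : 'I_n -> R -> R[i]).

Definition region_bounded_by_analytic_curves :=
  [/\ [/\ D !=set0, open D, connected D & bounded_set D],
      forall i, analytic_jordan_curve (gamma i),
      trivIset setT (fun i => range (gamma i)) &
      frontier D = \bigcup_i range (gamma i)].

(* The integral of g over the union of the curves with respect to |dz|. *)
Definition arclength_integral (g : R[i] -> R) : \bar R :=
  (\sum_(i < n) \int[lebesgue_measure]_(t in `[0%R, 1%R])
     (g (gamma i t) * modulus (curve_deriv (gamma i) t))%:E)%E.

(* Since the curves are regular, a set is null for arc length iff its
   parameters form a Lebesgue null set. *)
Definition ae_arclength (P : R[i] -> Prop) := forall i,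
  {ae lebesgue_measure, forall t : R, t \in `[0, 1] -> P (gamma i t)}.

(* {z in D : |z - zeta| <= (1 + alpha) dist(z, frontier D)} *)
Definition approach_region (alpha : R) (zeta : R[i]) : set R[i] :=
  [set z | D z /\ forall w, frontier D w ->
     modulus (z - zeta) <= (1 + alpha) * modulus (z - w)].

Definition nontangential_limit f (zeta l : R[i]) := forall alpha : R,
  0 < alpha ->
  f z @[z --> within (approach_region alpha zeta) (nbhs zeta)] --> l.

Definition L2_boundary fb :=
  [/\ forall i, measurable_fun (`[0, 1] : set R)
                  (fun t : R => complex.Re (fb (gamma i t))),
      forall i, measurable_fun (`[0, 1] : set R)
                  (fun t : R => complex.Im (fb (gamma i t))) &
      (arclength_integral (fun zeta => (modulus (fb zeta) ^+ 2)%R) < +oo)%E].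

Definition boundary_values f fb := L2_boundary fb /\
  ae_arclength (fun zeta => nontangential_limit f zeta (fb zeta)).

End Boundary.
End Definitions.

(* Main.v *)
Require Import Defs.
From HB Require Import structures.
From mathcomp Require Import all_boot all_order all_algebra.
From mathcomp Require Import complex.
From mathcomp Require Import all_classical all_reals all_analysis.

Set Implicit Arguments.
Unset Strict Implicit.
Unset Printing Implicit Defensive.

Import Order.TTheory GRing.Theory Num.Theory numFieldNormedType.Exports.

Local Open Scope classical_set_scope.
Local Open Scope ring_scope.
Local Open Scope complex_scope.

(* An interpolating polynomial does the job: it is bounded on the bounded
   region D, so |f|^2 has a constant harmonic majorant, and it is its own
   boundary value. By Bezout, if Q is the product of the (X - z_i)^(k+1) over
   i <> j, then u Q = 1 mod (X - z_j)^(k+1) for some u, and the polynomials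
   u Q (X - z_j)^l / l! form the dual basis of the Hermite conditions; f is the
   combination of these with coefficients a_(j,l), so that |f|^2 is at most a
   constant times the sum of the |a_(j,l)|^2. The curves have finite length
   because the derivative of a real-analytic function is real-analytic, hence
   continuous. *)

(** * Hermite interpolation by polynomials *)

Section HermiteInterpolation.

(** Each differentiation lowers the multiplicity of the root [a] by at most one, so after [l <= n]
    of them a factor X - a remains. *)
Lemma dvdp_derivn_root (F : fieldType) (a : F) (n l : nat) (p : {poly F}) :
  (l <= n)%N -> ('X - a%:P) ^+ n.+1 %| p -> (p^`(l)).[a] = 0.
Proof.
elim: l n p => [|l IHl] n p.
  rewrite derivn0 exprS => _ /(dvdp_trans (dvdp_mulr _ (dvdpp _))).
  by rewrite dvdp_XsubCl => /eqP.
case: n => // n ln /dvdpP[q ->]; rewrite derivSn; apply: (IHl n) => //.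
have dvdX : ('X - a%:P) ^+ n.+1 %| ('X - a%:P) ^+ n.+2 by exact: dvdp_exp2l.
rewrite derivM deriv_exp derivXsubC mul1r /= dvdp_add ?(dvdp_mull _ dvdX)//.
by rewrite -mulr_natr mulrCA dvdp_mulIl.
Qed.

Lemma derivn_XsubC_exp (F : fieldType) (a : F) (n l : nat) :
  ((('X - a%:P) ^+ n)^`(l)).[a] = n`!%:R *+ (n == l).
Proof.
elim: n l => [|n IHn] [|l].
- by rewrite derivn0 expr0 hornerC.
- by rewrite expr0 -polyC1 derivnC horner0.
- by rewrite derivn0 exprS hornerM hornerXsubC subrr mul0r.
rewrite derivSn deriv_exp derivXsubC mul1r derivnMn hornerMn IHn.
by rewrite eqSS factS mulnC natrM mulr_natr mulrnAC.
Qed.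

Lemma hermite_basis (F : numFieldType) (m : nat) (z : 'I_m -> F) (k : nat)
    (j : 'I_m) (l : 'I_k.+1) : injective z ->
  exists p : {poly F}, forall (j' : 'I_m) (l' : 'I_k.+1),
    (p^`(l')).[z j'] = ((j' == j) && (l' == l))%:R.
Proof.
move=> z_inj.
pose X i := ('X - (z i)%:P) ^+ k.+1; pose Q := \prod_(i | i != j) X i.
(* Coprimality reduces to [Q] not vanishing at [z j], which holds because the nodes are distinct. *)
have coQX : coprimep Q (X j).
  rewrite coprimep_sym coprimep_expl// coprimep_sym coprimep_XsubC.
  rewrite /root horner_prod prodf_seq_neq0.
  apply/allP => i _; apply/implyP => ij.
  by rewrite horner_exp hornerXsubC expf_neq0// subr_eq0 inj_eq// eq_sym.
have [[u v] /= uv1] := Bezout_eq1_coprimepP _ _ coQX.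
pose e := (l`!%:R)^-1 *: ('X - (z j)%:P) ^+ l.
exists (u * Q * e) => j' l'; case: (eqVneq j' j) => [->|neq_j] /=.
  (* At [z j] itself: the product differs from [e] by a multiple of [X j], which derivatives of
     order at most [k] do not see. *)
  have -> : u * Q * e = e - v * e * X j.
    by apply/eqP; rewrite eq_sym subr_eq [v * e * _]mulrAC -mulrDl uv1 mul1r.
  rewrite derivnB hornerD hornerN.
  rewrite [X in _ - X](@dvdp_derivn_root _ _ k) ?dvdp_mull// -1?ltnS// subr0.
  rewrite derivnZ hornerZ derivn_XsubC_exp mulrnAr mulVf ?pnatr_eq0//.
    by rewrite (inj_eq val_inj) eq_sym.
  by rewrite -lt0n fact_gt0.
(* At any other node, [X j'] is one of the factors of [Q]. *)
apply: (@dvdp_derivn_root _ _ k); first by rewrite -ltnS.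
rewrite dvdp_mulr// dvdp_mull// /Q (bigD1 j')//=; exact: dvdp_mulr.
Qed.

End HermiteInterpolation.

(** * Termwise differentiation of power series *)

Section PowerSeries.
Variable R : realType.
Implicit Types (c : R^nat) (g : R -> R) (x y r t : R).

(** The difference y^n - x^n is y - x times a sum of [n] products, each at least x^(n-1). This
    absorbs the factor [n] that differentiation produces. *)
Lemma derivXn_le x y n : 0 <= x -> x <= y ->
  n%:R * x ^+ n.-1 * (y - x) <= y ^+ n.
Proof.
move=> x0 xy.
suff: n%:R * x ^+ n.-1 * (y - x) <= y ^+ n - x ^+ n.
  by move=> /le_trans; apply; rewrite lerBlDr lerDl exprn_ge0.
case: n => [|n]; first by rewrite !mul0r !expr0 subrr.
rewrite subrXX mulrC ler_wpM2l ?subr_ge0//= mulr_natl.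
rewrite -[X in _ *+ X]card_ord -sumr_const ler_sum// => i _.
have -> : x ^+ n = x ^+ (n - i) * x ^+ i by rewrite -exprD subnK// -ltnS.
by rewrite ler_wpM2r ?exprn_ge0// lerXn2r// nnegrE (le_trans x0).
Qed.

(* For |h| < y < r, the term n |c_n| |h|^(n-1) is at most |c_n| y^n / (y - |h|). *)
Lemma cvg_pseries_diffs c r : (forall h, `|h| < r -> cvgn (pseries c h)) ->
  forall h, `|h| < r -> cvgn (pseries (pseries_diffs c) h).
Proof.
move=> cvg_c h hr.
pose y := (`|h| + r) / 2; pose y' := (y + r) / 2.
have hy : `|h| < y by rewrite midf_lt.
have y0 : 0 < y by exact: le_lt_trans hy.
have yr : y < r by rewrite midf_lt.
have [yy' y'r] : y < y' /\ y' < r by rewrite !midf_lt.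
have y'0 : 0 < y' by exact: lt_trans yy'.
(* Mere convergence at the larger radius [y'] gives absolute convergence at [y]. *)
have cvg_y : cvgn (series (fun n => `|c n| * y ^+ n)).
  apply: (@is_cvg_pseries_inside_norm _ c y'); last by rewrite !gtr0_norm.
  by apply: cvg_c; rewrite gtr0_norm.
apply: normed_cvg.
have yh0 : 0 < y - `|h| by rewrite subr_gt0.
apply: (@series_le_cvg _ _
  (fun n => (y - `|h|)^-1 * (`|c n.+1| * y ^+ n.+1))) => //.
- by move=> n; exact: normr_ge0.
- by move=> n; rewrite mulr_ge0 ?invr_ge0 ?mulr_ge0 ?exprn_ge0// ltW.
- move=> n; rewrite /= /pseries_diffs !normrM normrX normr_nat.
  rewrite ler_pdivlMl// mulrC (mulrC _%:R) -!mulrA ler_wpM2l// mulrA.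
  exact: (@derivXn_le _ _ n.+1 _ (ltW hy)).
apply: is_cvg_seriesZ.
(* The differentiated series starts from [c 1], hence the shift by one index. *)
have -> : series (fun n => `|c n.+1| * y ^+ n.+1) =
    (fun n => series (fun n => `|c n| * y ^+ n) n.+1 - `|c 0| * y ^+ 0).
  by apply/funext => n; rewrite /series/= big_nat_recl// addrC addKr.
apply/cvg_ex; eexists; apply: cvgB; last exact: cvg_cst.
by rewrite cvg_shiftS; exact: cvg_y.
Qed.

(** A power series can be differentiated term by term with the same radius, so the derivative is
    again given by a power series. Applied twice, this makes the derivative continuous. *)
Lemma real_analytic_derive1 g t : real_analytic_at g t ->
  {for t, continuous g} /\ real_analytic_at (derive1 g) t.
Proof.
move=> [c [r [r0 cvg_g]]].
have cvg0 h : `|h| < r -> cvgn (pseries c h).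
  by move=> /cvg_g cg; apply/cvg_ex; exists (g (t + h)).
have cvg1 := cvg_pseries_diffs cvg0.
have cvg2 := cvg_pseries_diffs cvg1.
have der h : `|h| < r ->
    is_derive (t + h) 1 g (limn (pseries (pseries_diffs c) h)).
  move=> hr.
  (* Termwise differentiation asks for convergence of the series and of its first two formal
     derivatives at a point [K] with |h| < K < r. *)
  pose K := (`|h| + r) / 2.
  have hK : `|h| < K by rewrite midf_lt.
  have Kr : K < r by rewrite midf_lt.
  have K0 : 0 < K by exact: le_lt_trans hK.
  have Kr' : `|K| < r by rewrite gtr0_norm.
  have dF : is_derive h 1 (fun x => limn (pseries c x))
              (limn (pseries (pseries_diffs c) h)).
    apply: (@pseries_snd_diffs _ c K) => //.
    - exact: (cvg0 _ Kr').
    - exact: (cvg1 _ Kr').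
    - exact: (cvg2 _ Kr').
    - by rewrite (gtr0_norm K0).
  have dS : is_derive (t + h) 1 (shift (- t)) 1 by exact: is_derive_shift.
  (* The expansion of [g] is available for |s - t| < r, which holds once [s] is within r - |h| of t
     + h. *)
  apply: (@near_eq_is_derive _ _ _
    ((fun x => limn (pseries c x)) \o shift (- t))).
    near=> s; have sr : `|s - t| < r.
      have -> : s - t = h - (t + h - s).
        by rewrite opprB [t + h]addrC opprD addrCA addNKr.
      rewrite (le_lt_trans (ler_normB _ _))// -ltrBrDl; near: s.
      by apply: (@cvgr_dist_lt _ _ _ _ _ id); [exact: cvg_id|rewrite subr_gt0].
    by rewrite /= (cvg_lim _ (cvg_g _ sr))// addrC subrK.
  rewrite -[X in is_derive _ _ _ X]mulr1; apply: is_derive1_comp => //.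
  by rewrite /= addrC addKr.
split.
  have := der 0; rewrite normr0 addr0 => /(_ r0) dg.
  by apply/differentiable_continuous/derivable1_diffP; case: dg.
exists (pseries_diffs c), r; split=> // h hr.
rewrite derive1E; have -> := @derive_val _ _ _ _ _ _ _ (der h hr).
exact: (cvg1 _ hr).
Unshelve. all: end_near. Qed.

End PowerSeries.

(** * Complex derivatives of polynomials *)

Section HornerDerivative.
Variable K : numFieldType.
Implicit Types (p : {poly K}) (z : K).

Lemma is_derive_horner p z : is_derive z (1 : K) (horner p : K -> K) p^`().[z].
Proof.
elim/poly_ind: p => [|p c IHp].
  rewrite deriv0 horner0 (_ : horner 0 = cst 0); first exact: is_derive_cst.
  by apply/funext => x; rewrite horner0.
have -> : horner (p * 'X + c%:P) = (horner p : K -> K) * id + cst c.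
  by apply/funext => x; rewrite hornerMXaddC.
rewrite derivMXaddC hornerD hornerMX -[X in is_derive _ _ _ X]addr0.
apply: is_deriveD; rewrite addrC.
suff -> : p^`().[z] * z + p.[z] = p.[z] *: (1 : K) + z *: p^`().[z].
  exact: is_deriveM.
by rewrite /GRing.scale/= mulr1 addrC mulrC.
Qed.

(** Turns the analytic derivatives of the interpolation conditions into formal ones. It is an
    equality of functions so that the induction can differentiate it again. *)
Lemma derive1n_horner p l : derive1n l (horner p : K -> K) = horner p^`(l).
Proof.
elim: l => [|l IHl]; first by rewrite derivn0.
rewrite derive1nS IHl derivnS; apply/funext => z.
by rewrite derive1E; exact/derive_val/is_derive_horner.
Qed.

Lemma continuous_horner_numField p : continuous (horner p : K -> K).
Proof.
move=> z; apply/differentiable_continuous/derivable1_diffP.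
by have [] := is_derive_horner p z.
Qed.

End HornerDerivative.

(** * Polynomials as elements of the Hardy space *)

Section HardyPolynomial.
Variable R : realType.
Implicit Types (D : set R[i]) (p : {poly R[i]}) (z : R[i]).

Lemma modulusE z : `|z| = (modulus z)%:C.
Proof. by rewrite normc_def; case: z. Qed.

Lemma modulus_ge0 z : 0 <= modulus z.
Proof. by rewrite -lecR -modulusE normr_ge0. Qed.

Lemma closure_bounded D : bounded_set D ->
  exists b : R[i], forall z, closure D z -> `|z| <= b.
Proof.
(* A point of the closure lies within distance 1 of a point of [D]. *)
move=> /pinfty_ex_gt0[b b0 Db]; exists (b + 1) => z Dz.
have [w [Dw]] := Dz _ (nbhsx_ballx z 1 ltr01).
rewrite -ball_normE /= => zw.
rewrite -[z](subrK w) (le_trans (ler_normD _ _))// addrC.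
by rewrite lerD ?(ltW zw)//; exact: Db.
Qed.

(** Bounding on the closure lets one constant serve both for the majorant on [D] and on the boundary
    curves. *)
Lemma horner_bounded_closure D p : bounded_set D ->
  exists2 B : R, 0 <= B & forall z, closure D z -> modulus p.[z] <= B.
Proof.
move=> /closure_bounded[b Db]; have [B pB] := poly_disk_bound p b.
(* [B] is a complex number; once it dominates a norm it is real and nonnegative, hence equal to its
   modulus. *)
exists (modulus B); first exact: modulus_ge0.
move=> z /Db/pB pzB.
by rewrite -lecR -!modulusE (le_trans pzB)// ger0_norm// (le_trans _ pzB).
Qed.

Lemma harmonic_cst D (c : R) : harmonic_on D (cst c).
Proof.
have dx (d : R) : partial_x (cst d : R[i] -> R) = cst 0.
  by apply/funext => z; rewrite /partial_x derive1_cst.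
have dy (d : R) : partial_y (cst d : R[i] -> R) = cst 0.
  by apply/funext => z; rewrite /partial_y derive1_cst.
have C1 (d : R) : C1_on D (cst d).
  move=> z _; split; [exact: derivable_cst..| |].
    by rewrite dx; exact: cst_continuous.
  by rewrite dy; exact: cst_continuous.
by split=> [|z _]; [split|]; rewrite ?dx ?dy ?dx ?dy //= addr0.
Qed.

Lemma hardy2_horner D p : bounded_set D -> hardy2 D (horner p).
Proof.
move=> bD; have [B B0 pB] := horner_bounded_closure p bD; split=> [z _|].
  by have [] := is_derive_horner p z.
exists (cst (B ^+ 2)) => [|z Dz]; first exact: harmonic_cst.
by rewrite lerXn2r ?nnegrE ?modulus_ge0//; exact/pB/subset_closure.
Qed.

Lemma nontangential_limit_horner D p z :
  nontangential_limit D (horner p) z p.[z].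
Proof.
by move=> alpha _; apply: cvg_within_filter; exact: continuous_horner_numField.
Qed.

End HardyPolynomial.

(** * Arc-length integrals and boundary values of polynomials *)

Section BoundaryIntegral.
Variable R : realType.
Implicit Types (x y : R -> R) (gamma : R -> R[i]) (p : {poly R[i]}).

(** Stated by components, since the analyticity of the curves and the measurability in [L2_boundary]
    both concern real and imaginary parts. *)
Lemma continuous_horner_curve gamma p :
  continuous (fun t => complex.Re (gamma t)) ->
  continuous (fun t => complex.Im (gamma t)) ->
  continuous (fun t => complex.Re p.[gamma t]) /\
  continuous (fun t => complex.Im p.[gamma t]).
Proof.
move=> cx cy; elim/poly_ind: p => [|p c [IHx IHy]].
  by split; under eq_fun do rewrite horner0; exact: cst_continuous.
have E (u v w : R[i]) : u * v + w =
    (complex.Re u * complex.Re v - complex.Im u * complex.Im v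
       + complex.Re w) +i*
    (complex.Re u * complex.Im v + complex.Im u * complex.Re v
       + complex.Im w).
  by case: u v w => [a b] [a' b'] [a'' b''].
split; under eq_fun do rewrite hornerMXaddC E /=.
- move=> t; apply: cvgD; last exact: cvg_cst.
  by apply: cvgB; apply: cvgM; [exact: IHx|exact: cx|exact: IHy|exact: cy].
- move=> t; apply: cvgD; last exact: cvg_cst.
  by apply: cvgD; apply: cvgM; [exact: IHx|exact: cy|exact: IHy|exact: cx].
Qed.

Lemma continuous_modulus x y : continuous x -> continuous y ->
  continuous (fun t => modulus (x t +i* y t)).
Proof.
move=> cx cy.
have -> : (fun t => modulus (x t +i* y t)) =
  Num.sqrt \o (fun t => x t ^+ 2 + y t ^+ 2) by [].
move=> t; apply: continuous_comp; last exact: sqrt_continuous.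
by apply: cvgD; apply: cvgM; [exact: cx|exact: cx|exact: cy|exact: cy].
Qed.

Lemma continuous_integrable01 (g : R -> R) : continuous g ->
  (@lebesgue_measure R).-integrable `[0, 1] (EFin \o g).
Proof.
move=> cg; apply: continuous_compact_integrable; first exact: segment_compact.
exact: continuous_subspaceT.
Qed.

Variables (n : nat) (gamma : 'I_n -> R -> R[i]).
Hypothesis gammaP : forall i, analytic_jordan_curve (gamma i).

Let cRe i : continuous (fun t => complex.Re (gamma i t)).
Proof. by move=> t; have [/(_ t)[/real_analytic_derive1[]]] := gammaP i. Qed.

Let cIm i : continuous (fun t => complex.Im (gamma i t)).
Proof. by move=> t; have [/(_ t)[_ /real_analytic_derive1[]]] := gammaP i. Qed.

Let speed i t := modulus (curve_deriv (gamma i) t).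

Let cspeed i : continuous (speed i).
Proof.
have [an _ _ _] := gammaP i; apply: continuous_modulus => t.
  by have [/real_analytic_derive1[_ /real_analytic_derive1[]]] := an t.
by have [_ /real_analytic_derive1[_ /real_analytic_derive1[]]] := an t.
Qed.

Let chorner i p : continuous (fun t => modulus p.[gamma i t] ^+ 2).
Proof.
have [cx cy] := continuous_horner_curve p (@cRe i) (@cIm i).
have cm : continuous (fun t => modulus p.[gamma i t]).
  have -> : (fun t => modulus p.[gamma i t]) =
      (fun t => modulus (complex.Re p.[gamma i t] +i*
                         complex.Im p.[gamma i t])).
    by apply/funext => t; case: (p.[gamma i t] : R[i]).
  exact: continuous_modulus.
by move=> t; apply: cvgM; exact: cm.
Qed.

(** The integral of [cst 1] is the total length of the boundary. The estimate serves both for the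
    finiteness in [L2_boundary] and for the final norm bound. *)
Lemma arclength_integral_horner_le p (B : R) :
  (forall i t, modulus p.[gamma i t] ^+ 2 <= B) ->
  (arclength_integral gamma (fun z => (modulus p.[z] ^+ 2)%R) <=
   B%:E * arclength_integral gamma (cst 1%R))%E.
Proof.
(* In the extended reals, [B] distributes over the sum because the lengths are nonnegative. *)
move=> pB; rewrite /arclength_integral ge0_sume_distrr; last first.
  by move=> i _; apply: integral_ge0 => t _; rewrite lee_fin mul1r modulus_ge0.
apply: lee_sum => i _.
have int1 : (@lebesgue_measure R).-integrable `[0, 1]
    (fun t => (1 * speed i t)%:E).
  apply: continuous_integrable01; under eq_fun do rewrite mul1r.
  exact: cspeed.
have intp : (@lebesgue_measure R).-integrable `[0, 1]
    (fun t => (modulus p.[gamma i t] ^+ 2 * speed i t)%:E).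
  apply: continuous_integrable01 => t.
  by apply: cvgM; [exact: chorner|exact: cspeed].
rewrite -integralZl//; apply: le_integral => //; first exact: integrableZl.
move=> t _; rewrite -EFinM lee_fin mul1r ler_wpM2r//; exact: modulus_ge0.
Qed.

Lemma arclength_fin : arclength_integral gamma (cst 1) \is a fin_num.
Proof.
apply/sum_fin_numP => i _ _; apply: integrable_fin_num => //.
apply: continuous_integrable01; under eq_fun do rewrite mul1r.
exact: cspeed.
Qed.

(** A polynomial is continuous on the whole plane, so the limits exist at every boundary point and
    no exceptional null set arises. *)
Lemma boundary_values_horner D p (B : R) :
  (forall i t, modulus p.[gamma i t] ^+ 2 <= B) ->
  boundary_values D gamma (horner p) (horner p).
Proof.
move=> pB; split; last first.
  by move=> i; apply: aeW => t _; exact: nontangential_limit_horner.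
have cp i := continuous_horner_curve p (@cRe i) (@cIm i).
split.
- move=> i; apply: measurable_funTS.
  apply: measurable_realfun.continuous_measurable_fun.
  by have [] := cp i.
- move=> i; apply: measurable_funTS.
  apply: measurable_realfun.continuous_measurable_fun.
  by have [] := cp i.
apply: le_lt_trans (arclength_integral_horner_le pB) _.
by rewrite -(fineK arclength_fin) -EFinM ltry.
Qed.

End BoundaryIntegral.

(** * The interpolant and the uniform constant *)

Theorem corollary1p8 (R : realType) (D : set R[i])
    (n : nat) (gamma : 'I_n -> R -> R[i])
    (m : nat) (z : 'I_m -> R[i]) (k : nat)
    (hD : region_bounded_by_analytic_curves D gamma)
    (hzD : forall j, D (z j)) (hz : injective z) :
  exists C : R, forall a : 'I_m -> 'I_k.+1 -> R[i],
    exists f fb : R[i] -> R[i],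
      [/\ hardy2 D f,
          forall (j : 'I_m) (l : 'I_k.+1), derive1n l f (z j) = a j l,
          boundary_values D gamma f fb &
          (((2 * pi)^-1)%:E *
             arclength_integral gamma (fun zeta => (modulus (fb zeta) ^+ 2)%R)
           <= (C * \sum_(j < m) \sum_(l < k.+1) modulus (a j l) ^+ 2)%:E)%E].
Proof.
have [[_ _ _ bD] gammaP _ frD] := hD.
have gammaD i t : closure D (gamma i t).
  suff [] : frontier D (gamma i t) by [].
  by rewrite frD; exists i => //; exists t.
have [p pz] := choice (fun jl : 'I_m * 'I_k.+1 => hermite_basis jl.1 jl.2 hz).
have [B B0 pB] : exists2 B : 'I_m * 'I_k.+1 -> R, forall jl, 0 <= B jl &
    forall jl z, closure D z -> modulus (p jl).[z] <= B jl.
  have /choice[B HB] : forall jl, exists B : R, 0 <= B /\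
      forall z, closure D z -> modulus (p jl).[z] <= B.
    by move=> jl; have [b] := horner_bounded_closure (p jl) bD; exists b.
  by exists B => jl; have [] := HB jl.
pose M := \sum_jl B jl.
(* On the boundary |f|^2 will be at most [M ^+ 2] times the sum of the |a_(j,l)|^2; integration adds
   the length as a factor. The constant is fixed before [a]. *)
exists ((2 * pi)^-1 * (M ^+ 2 * fine (arclength_integral gamma (cst 1)))) => a.
pose S := \sum_(j < m) \sum_(l < k.+1) modulus (a j l) ^+ 2.
pose q := \sum_jl a jl.1 jl.2 *: p jl.
have aS jl : modulus (a jl.1 jl.2) <= Num.sqrt S.
  rewrite -[leLHS]ger0_norm ?modulus_ge0// -sqrtr_sqr ler_wsqrtr//.
  rewrite /S pair_bigA (bigD1 jl)//= lerDl sumr_ge0// => *.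
  exact: exprn_ge0 (modulus_ge0 _).
have S0 : 0 <= S.
  by do 2!apply: sumr_ge0 => ? _; exact: exprn_ge0 (modulus_ge0 _).
(* By the triangle inequality |q| is at most the sum of the |a_(j,l)| [B (j, l)], hence at most [M]
   times the square root of [S]. *)
have qB i t : modulus q.[gamma i t] ^+ 2 <= M ^+ 2 * S.
  rewrite -[S]sqr_sqrtr// -exprMn lerXn2r ?nnegrE ?modulus_ge0//.
    by rewrite mulr_ge0 ?sqrtr_ge0// sumr_ge0.
  rewrite -lecR -modulusE horner_sum (le_trans (ler_norm_sum _ _ _))//.
  rewrite mulr_suml rmorph_sum ler_sum// => jl _.
  rewrite hornerZ normrM !modulusE -rmorphM lecR mulrC.
  by rewrite ler_pM ?modulus_ge0// pB.
exists (horner q), (horner q); split.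
- exact: hardy2_horner.
(* By duality of the basis, only the term of index [(j, l)] survives. *)
- move=> j l; rewrite derive1n_horner raddf_sum horner_sum (bigD1 (j, l))//=.
  rewrite derivnZ hornerZ pz !eqxx mulr1 big1 ?addr0// => -[j' l'] neq.
  rewrite derivnZ hornerZ pz /=; move: neq; rewrite xpair_eqE.
  by rewrite ![_ == j']eq_sym ![_ == l']eq_sym => /negPf ->; rewrite mulr0.
- exact: boundary_values_horner qB.
rewrite -mulrA EFinM lee_pmul2l//; last first.
  by rewrite lte_fin invr_gt0 mulr_gt0// pi_gt0.
apply: le_trans (arclength_integral_horner_le gammaP qB) _.
by rewrite -(fineK (arclength_fin gammaP)) -EFinM lee_fin /= mulrAC.
Qed.
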